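(* For $(t_1,t_2)=(t,1)$ and all $1\le i\le n$, the generalized cyclotomic coefficients $\tilde c_{n,i-1}(q,t):=\tilde c_{n,i-1}(q,t,1)$ are given by $$\tilde c_{n,i-1}(q,t)=\frac{p_{n-i}(q^{2i}t^{-1};q^{4i}\,|\,q^4)}{p_{n-i}(q^{2i};q^{4i}\,|\,q^4)}\left(\prod_{k=2}^i\frac{q^{2k-1}t^{-1}-q^{-2k+1}t}{q^{2k-1}-q^{-2k+1}}\right)c_{n,i-1}(q),$$ where $p_m(x;\beta\,|\,q)$ are the Macdonald symmetric polynomials of type $A_1$ and $c_{n,i-1}(q)$ are the classical cyclotomic coefficients.
   Context: $q$ and $t,t_1,t_2$ are indeterminates. $\{n\}=q^n-q^{-n}$, $[n]_q=\{n\}_q/\{1\}_q$, $\begin{bmatrix}n\\ m\end{bmatrix}_q=\prod_{k=1}^m\frac{[n-k+1]_q}{[m-k+1]_q}$; a subscript $q^2$ means $q$ is replaced by $q^2$. **Classical cyclotomic coefficients:** $c_{n,i-1}(q)=\frac{1}{q^2-q^{-2}}\prod_{p=n-i+1}^{n+i-1}(q^{2p}-q^{-2p})$, $1\le i\le n$. **Generalized cyclotomic coefficients** $\tilde c_{n,i-1}(q,t_1,t_2)$, $i\ge1$, $n\ge0$: defined by $$\sum_{n=0}^\infty\tilde c_{n,i-1}(q,t_1,t_2)\lambda^n=\frac{\det(B_{2i}(q,t_1,t_2;\lambda))}{\prod_{N=1}^{2i-1}\gamma_N}$$ (rational function of $\lambda$ expanded as a power series at $\lambda=0$), where $B_{2i}$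 is the $2i\times2i$ matrix $$\begin{pmatrix} 0&\alpha_1^{(i)}&0&\alpha_2^{(i)}&\cdots&0&\alpha_i^{(i)}\\ \beta_1&\gamma_1&0&0&\cdots&0&0\\ \beta_2&b_{2,1}&\gamma_2&0&\cdots&0&0\\ \beta_3&b_{3,1}&b_{3,2}&\gamma_3&\cdots&0&0\\ \vdots&\vdots&\vdots&\vdots&\ddots&\vdots&\vdots\\ \beta_{2i-1}&b_{2i-1,1}&b_{2i-1,2}&b_{2i-1,3}&\cdots&b_{2i-1,2i-2}&\gamma_{2i-1} \end{pmatrix}$$ with $\alpha_k^{(i)}=(-1)^{i-k}\begin{bmatrix}2i-1\\i-k\end{bmatrix}_{q^2}$, $\beta_N=[N]_{q^2}$, $\gamma_N=q^{2N}t_1^{-1}+q^{-2N}t_1-\lambda-\lambda^{-1}$, and $b_{p,N}=(-1)^r(\{p+N\}-\{p-N\})(t_r-t_r^{-1})$ where $r\in\{1,2\}$, $r\equiv p-N+1\pmod2$. **Macdonald polynomials of type $A_1$:** $p_m(x;\beta\,|\,q)$, $m\ge0$, are the symmetric Laurent polynomials in $x$ (polynomials in $x+x^{-1}$, with coefficients rational in $q,\beta$) with $p_0=1$, $p_1=x+x^{-1}$ and, for $m\ge1$, $$p_{m+1}=(x+x^{-1})p_m-\frac{q^{m/2}-q^{-m/2}}{\beta^{1/2}q^{m/2}-\beta^{-1/2}q^{-m/2}}\cdot\frac{\beta q^{(m-1)/2}-\beta^{-1}q^{(1-m)/2}}{\beta^{1/2}q^{(m-1)/2}-\beta^{-1/2}q^{(1-m)/2}}\,p_{m-1}.$$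 The notation $p_m(x;q^{4i}\,|\,q^4)$ means that $q$ is replaced by $q^4$ and $\beta$ by $q^{4i}$. *)

(* Defs.v *)
From HB Require Import structures.
From mathcomp Require Import all_boot all_order all_algebra.
From mathcomp Require Import mpoly.

Set Implicit Arguments.
Unset Strict Implicit.
Unset Printing Implicit Defensive.

Import GRing.Theory.
Local Open Scope ring_scope.

Lemma tofrac_repr (R : idomainType) (f : {fraction R}) :
  f * tofrac (\d_(repr f)) = tofrac (\n_(repr f)).
Proof.
have d0 := denom_ratioP (repr f).
rewrite -{1}[f]reprK; unlock tofrac.
have M (x y : {ratio R}) : \pi_({fraction R})%qT x * \pi_({fraction R})%qT y =
    \pi_({fraction R})%qT (FracField.mulf x y).
  by rewrite (FracField.pi_mul x y).
rewrite M; apply/eqmodP=> /=.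
rewrite FracField.equivfE /FracField.mulf.
by rewrite !numden_Ratio ?mulf_neq0 ?oner_eq0 //= !mulr1 mulrC.
Qed.

Section Expansion.
Variable K : fieldType.

(* The first [n] coefficients of the power series P / Q (for Q`_0 != 0), by
   solving \sum_(j <= m) Q`_(m - j) * a_j = P`_m for a_m, m = 0, 1, ... *)
Fixpoint quot_coefs (P Q : {poly K}) (n : nat) : seq K :=
  if n is m.+1 then
    let a := quot_coefs P Q m in
    rcons a ((P`_m - \sum_(j < m) Q`_(m - j) * a`_j) / Q`_0)
  else [::].

Definition quot_coef (P Q : {poly K}) (n : nat) : K :=
  (quot_coefs P Q n.+1)`_n.

(* The coefficient of lambda^n in the expansion at lambda = 0 of f in
   K(lambda).  The fraction is first put in lowest terms, so the denominator
   is nonzero at 0 exactly when f is regular at 0 (see [series_coefP]); the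
   value is junk when f has a pole at 0. *)
Definition series_coef (f : {fraction {poly K}}) (n : nat) : K :=
  let P := \n_(repr f) in let Q := \d_(repr f) in
  quot_coef (P %/ gcdp P Q) (Q %/ gcdp P Q) n.

Lemma size_quot_coefs P Q n : size (quot_coefs P Q n) = n.
Proof. by elim: n => //= n IH; rewrite size_rcons IH. Qed.

Lemma nth_quot_coefs P Q n j :
  (j < n)%N -> (quot_coefs P Q n)`_j = quot_coef P Q j.
Proof.
elim: n => // n IH; rewrite ltnS leq_eqVlt => /predU1P[->|jn] //.
by rewrite /= nth_rcons size_quot_coefs jn IH.
Qed.

Lemma quot_coefP (P Q : {poly K}) (n : nat) : Q`_0 != 0 ->
  \sum_(j < n.+1) Q`_(n - j) * quot_coef P Q j = P`_n.
Proof.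
move=> Q0; rewrite big_ord_recr /= subnn {2}/quot_coef /=.
rewrite nth_rcons size_quot_coefs ltnn eqxx mulrC divfK //.
rewrite -[RHS](subrK (\sum_(j < n) Q`_(n - j) * quot_coef P Q j)) addrC.
by congr (_ - _ + _); apply: eq_bigr => j _; rewrite nth_quot_coefs.
Qed.

Lemma quot_coef_uniq (P Q : {poly K}) (a : nat -> K) : Q`_0 != 0 ->
  (forall n, \sum_(j < n.+1) Q`_(n - j) * a j = P`_n) ->
  forall n, a n = quot_coef P Q n.
Proof.
move=> Q0 Ha n; elim/ltn_ind: n => n IH.
have := quot_coefP P n Q0; rewrite -(Ha n) !big_ord_recr /= subnn.
have -> : \sum_(j < n) Q`_(n - j) * quot_coef P Q j =
          \sum_(j < n) Q`_(n - j) * a j.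
  by apply: eq_bigr => j _; rewrite IH.
by move/addrI/(mulfI Q0).
Qed.

Lemma series_coefP (f : {fraction {poly K}}) (P Q : {poly K}) (n : nat) :
  Q`_0 != 0 -> f = tofrac P / tofrac Q ->
  \sum_(j < n.+1) Q`_(n - j) * series_coef f j = P`_n.
Proof.
move=> Q0 fPQ; set N := \n_(repr f); set D := \d_(repr f).
have D0 : D != 0 := denom_ratioP (repr f).
have Qn0 : Q != 0 by apply: contraNneq Q0 => ->; rewrite coef0.
have ND : N * Q = P * D.
  have Qf0 : tofrac Q != 0 by rewrite tofrac_eq0.
  apply/eqP; rewrite -tofrac_eq !tofracM -tofrac_repr -/D.
  by rewrite {1}fPQ mulrAC divfK.
set g := gcdp N D; set N' := N %/ g; set D' := D %/ g.
have g0 : g != 0 by rewrite gcdp_eq0 negb_and D0 orbT.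
have eN : N = N' * g by rewrite divpK // dvdp_gcdl.
have eD : D = D' * g by rewrite divpK // dvdp_gcdr.
have cop : coprimep N' D' by rewrite coprimep_div_gcd // D0 orbT.
have ND' : N' * Q = P * D'.
  by apply: (mulIf g0); rewrite mulrAC -eN -mulrA -eD.
have /dvdpP[h eQ] : D' %| Q.
  by rewrite -(Gauss_dvdpr _ (_ : coprimep D' N')) 1?coprimep_sym // ND' dvdp_mull.
have D'0 : D' != 0 by apply: contraNneq D0 => D'0; rewrite eD D'0 mul0r.
have eP : P = h * N'.
  by apply: (mulIf D'0); rewrite -ND' eQ mulrCA mulrA.
have D'00 : D'`_0 != 0.
  by move: Q0; rewrite eQ coef0M mulf_eq0 negb_or => /andP[].
set C := \poly_(j < n.+1) series_coef f j.
have coefAC (A : {poly K}) m : (m <= n)%N ->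
    (A * C)`_m = \sum_(j < m.+1) A`_(m - j) * series_coef f j.
  move=> mn; rewrite coefMr; apply: eq_bigr => j _.
  by rewrite coef_poly (leq_trans (ltn_ord j)).
rewrite -coefAC // eP eQ -mulrA !coefM; apply: eq_bigr => j _.
by rewrite coefAC ?leq_subr // quot_coefP.
Qed.

End Expansion.

Section Cyclotomic.
Variable K : fieldType.
Implicit Types q : K.

Definition qbrace q (n : int) : K := q ^ n - q ^ (- n).

Definition qint q (n : int) : K := qbrace q n / qbrace q 1.

Definition qbinom q (n m : nat) : K :=
  \prod_(1 <= k < m.+1) (qint q (n%:Z - k%:Z + 1) / qint q (m%:Z - k%:Z + 1)).

(* c_(n,j), i.e. the usual c_(n,i-1) with i = j + 1; meant for j < n. *)
Definition cyclo_coef q (n j : nat) : K :=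
  (q ^+ 2 - q ^- 2)^-1 *
  \prod_(n - j <= p < (n + j).+1) (q ^+ (2 * p) - q ^- (2 * p)).

Definition cyclo_alpha q (i k : nat) : K :=
  (-1) ^+ (i - k) * qbinom (q ^+ 2) (2 * i - 1) (i - k).

Definition cyclo_beta q (N : nat) : K := qint (q ^+ 2) N%:Z.

Definition cyclo_b q (t1 t2 : K) (p N : nat) : K :=
  let r := if odd (p - N) then 2%N else 1%N in
  let tr := if odd (p - N) then t2 else t1 in
  (-1) ^+ r * (qbrace q (p%:Z + N%:Z) - qbrace q (p%:Z - N%:Z)) * (tr - tr^-1).

Local Notation ratfun := {fraction {poly K}}.
Local Notation cst a := (tofrac (a%:P) : ratfun).
Local Notation lambda := (tofrac 'X : ratfun).

Definition cyclo_gamma q (t1 : K) (N : nat) : ratfun :=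
  cst (q ^+ (2 * N) * t1^-1 + q ^- (2 * N) * t1) - lambda - lambda^-1.

(* Rows and columns are numbered from 0, so that row p >= 1 carries beta_p and
   gamma_p, and alpha_k sits in column 2 k - 1 of row 0. *)
Definition cyclo_mx q (t1 t2 : K) (i : nat) : 'M[ratfun]_(2 * i) :=
  \matrix_(p, N)
    if p == 0%N :> nat then
      if odd N then cst (cyclo_alpha q i N.+1./2) else 0
    else if N == 0%N :> nat then cst (cyclo_beta q p)
    else if (N < p)%N then cst (cyclo_b q t1 t2 p N)
    else if N == p then cyclo_gamma q t1 p
    else 0.

(* c~_(n,j), i.e. c~_(n,i-1) with i = j + 1. *)
Definition gen_cyclo_coef q (t1 t2 : K) (n j : nat) : K :=
  let i := j.+1 in
  series_coef
    (\det (cyclo_mx q t1 t2 i) / \prod_(1 <= N < 2 * i) cyclo_gamma q t1 N) n.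

(* The parameters are square roots: [s] stands for q^(1/2) and [b] for
   beta^(1/2). *)
Definition macdonald_rec (s b : K) (m : nat) : K :=
  (s ^+ m - s ^- m) / (b * s ^+ m - b^-1 * s ^- m) *
  ((b ^+ 2 * s ^+ m.-1 - b ^- 2 * s ^- m.-1) /
   (b * s ^+ m.-1 - b^-1 * s ^- m.-1)).

(* p_m as a polynomial in the variable x + x^-1. *)
Fixpoint macdonald_poly (s b : K) (m : nat) : {poly K} :=
  match m with
  | 0 => 1
  | 1 => 'X
  | (m''.+1 as m').+1 =>
      'X * macdonald_poly s b m' -
      macdonald_rec s b m' *: macdonald_poly s b m''
  end.

(* p_m(x; b^2 | s^2) *)
Definition macdonald (m : nat) (x s b : K) : K :=
  (macdonald_poly s b m).[x + x^-1].

End Cyclotomic.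

Definition ratqt (k : fieldType) := {fraction {mpoly k[2]}}.

Definition indet_q (k : fieldType) : ratqt k := tofrac ('X_ord0 : {mpoly k[2]}).
Definition indet_t (k : fieldType) : ratqt k :=
  tofrac ('X_ord_max : {mpoly k[2]}).

(* Main.v *)
Require Import Defs.
From mathcomp Require Import all_boot all_order all_algebra.
From mathcomp Require Import mpoly.
From mathcomp Require Import ring zify.

(** Write i = j + 1, Q = q^2, {n} = Q^n - Q^-n and z = lambda + lambda^-1.

    For t_2 = 1 the entries b_(p,N) with p - N odd vanish, so only the odd rows
    and columns of the matrix interact with the alphas.  On these the lower
    right block is M - z, where M is lower triangular with eigenvalues
    A_k = Q^(2k+1)/t + t/Q^(2k+1), and expanding along the first row gives
    det / prod gamma_N = - alpha (M - z)^-1 beta.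

    Up to the factor {1}...{2j+1}, the row alpha is
    a_j(k) = (-1)^(j+k) / ({j-k}! {j+k+1}!), where {m}! = {1}...{m}.  Its tail
    sums telescope, and this makes M bidiagonal on these rows:
    a_j M = A_j a_j + c_j a_(j-1), with c_j the factor of the product in the
    statement at l = j + 1 ([alpha_row_bidiagonal]).  Hence a_j (M - z)^-1 is
    obtained by descending through a_(j-1), ..., a_0.  As a_m beta = 0 for
    m > 0 ([alpha_row_beta]), only the last term contributes, and
    alpha (M - z)^-1 beta is a constant over prod_(l <= j) (A_l - z)
    ([resolvent_row_beta]).  In terms of lambda the generating function is thus
    a constant times lambda^i / D, where
    D = prod_(l < i) (1 - A_l lambda + lambda^2) ([cyclo_ratio]).

    The roots of D form two geometric progressions of ratio Q^2, so
    D(Q lambda) / D(lambda / Q) telescopes to a quotient of two quadratic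
    polynomials.  The resulting functional equation of 1 / D is a three-term
    recurrence for its coefficients g_m: it is the recurrence of the Rogers
    polynomials, which are the Macdonald polynomials of type A_1 in another
    normalization ([rogers_rec_eig_denom], [macdonald_rogers]).  The
    normalization cancels in p_m(x) / p_m(Q^i), and at x = Q^i the recurrence
    is solved by a product of braces ([rogers_rec_principal]); this product and
    the classical coefficient c_(n,j) account for the constant. *)

Set Implicit Arguments.
Unset Strict Implicit.
Unset Printing Implicit Defensive.

Import GRing.Theory.
Local Open Scope ring_scope.

(** * Braces, their factorials and the Gaussian binomials *)

Section BraceFactorial.
Variable K : fieldType.
Variable Q : K.
Hypothesis Q0 : Q != 0.
Hypothesis Q1 : forall n, (0 < n)%N -> Q ^+ n != 1.

Definition brace (x : K) (n : nat) : K := x ^+ n - x ^- n.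

(** The form in which [field] asks for a brace to be nonzero, with the
    denominator x cleared. *)
Lemma brace_num (x y : K) : x - x^-1 != 0 -> x != 0 -> y = x * x - 1 -> y != 0.
Proof.
move=> h x0 ->; apply: contra_neq h => /eqP; rewrite subr_eq0 => /eqP e.
by apply/eqP; rewrite subr_eq0; apply/eqP/(mulIf x0); rewrite e mulVf.
Qed.

Definition brace_fact (n : nat) : K := \prod_(0 <= l < n) brace Q l.+1.

Lemma brace_neq0 n : (0 < n)%N -> brace Q n != 0.
Proof.
move=> n0; have: Q ^+ (n + n) != 1 by rewrite Q1 // addn_gt0 n0.
apply: contra_neq => /eqP; rewrite /brace subr_eq0 => /eqP e.
by rewrite exprD {1}e mulVf // expf_neq0.
Qed.

Lemma brace_factS n : brace_fact n.+1 = brace_fact n * brace Q n.+1.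
Proof. by rewrite /brace_fact big_nat_recr. Qed.

Lemma brace_fact_neq0 n : brace_fact n != 0.
Proof.
elim: n => [|n IH]; first by rewrite /brace_fact big_geq ?oner_eq0.
by rewrite brace_factS mulf_neq0 // brace_neq0.
Qed.

(** The value 0 for k > j is what 1/{j-k}! has to be for the recursion
    [brace_fact_invS] to hold at every k, the point k = j included; it saves
    the boundary terms in the telescoping sums. *)
Definition brace_fact_inv (j k : nat) : K :=
  if (k <= j)%N then (brace_fact (j - k))^-1 else 0.

Lemma brace_fact_invS j k :
  brace_fact_inv j k.+1 =
  (Q ^+ j / Q ^+ k - Q ^+ k / Q ^+ j) * brace_fact_inv j k.
Proof.
rewrite /brace_fact_inv; have Qk : Q ^+ k != 0 by rewrite expf_neq0.
have Qj : Q ^+ j != 0 by rewrite expf_neq0.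
case: (ltngtP k j) => [lt_kj | // | ->]; first 1 last.
- by rewrite mulr0.
- by rewrite subrr mul0r.
have -> : (j - k = (j - k.+1).+1)%N by rewrite subnS prednK ?subn_gt0.
rewrite brace_factS invfM.
have -> : Q ^+ j / Q ^+ k - Q ^+ k / Q ^+ j = brace Q (j - k.+1).+1.
  rewrite -subSn // subSS /brace -{1 2}(subnK (ltnW lt_kj)) exprD.
  by field; rewrite Qk expf_neq0.
by rewrite mulrC -mulrA mulVf ?mulr1 ?brace_neq0.
Qed.

End BraceFactorial.

Section Translate.
Variable K : fieldType.
Variable Q : K.
Hypothesis Q0 : Q != 0.
Hypothesis Q1 : forall n, (0 < n)%N -> Q ^+ n != 1.

Lemma qbraceE (x : K) (n : nat) : qbrace x n%:Z = brace x n.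
Proof. by rewrite /qbrace /brace -exprnN. Qed.

Lemma qint_ratio (n m : nat) : qint Q n / qint Q m = brace Q n / brace Q m.
Proof.
rewrite /qint !qbraceE; have := brace_neq0 Q0 Q1 (ltn0Sn 0).
move: (brace Q 1) => b b0; rewrite invfM invrK mulrACA mulVf ?mulr1 //.
Qed.

Lemma brace_fact0 : brace_fact Q 0 = 1.
Proof. by rewrite /brace_fact big_geq. Qed.

Lemma brace_fact_falling n r : (r <= n)%N ->
  (\prod_(1 <= k < r.+1) brace Q (n.+1 - k)) * brace_fact Q (n - r) = brace_fact Q n.
Proof.
elim: r => [|r IH] rn; first by rewrite big_geq // mul1r subn0.
rewrite big_nat_recr //= -(IH (ltnW rn)) subSS -mulrA; congr (_ * _).
have -> : (n - r = (n - r.+1).+1)%N by lia.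
by rewrite brace_factS mulrC.
Qed.

Lemma qbinomE n r : (r <= n)%N ->
  qbinom Q n r = brace_fact Q n / (brace_fact Q r * brace_fact Q (n - r)).
Proof.
move=> rn; rewrite /qbinom.
have -> : \prod_(1 <= k < r.+1) (qint Q (n%:Z - k%:Z + 1) / qint Q (r%:Z - k%:Z + 1)) =
    \prod_(1 <= k < r.+1) (brace Q (n.+1 - k) / brace Q (r.+1 - k)).
  apply: eq_big_nat => k kr.
  have -> : n%:Z - k%:Z + 1 = (n.+1 - k)%N :> int by lia.
  have -> : r%:Z - k%:Z + 1 = (r.+1 - k)%N :> int by lia.
  exact: qint_ratio.
rewrite prodf_div -(brace_fact_falling rn) -[X in _ / (X * _)](brace_fact_falling (leqnn r)).
have := brace_fact_neq0 Q0 Q1 (n - r).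
rewrite subnn brace_fact0 mulr1 => b0.
by rewrite invfM mulrACA mulfV // mulr1.
Qed.

End Translate.

(** * The rows of alternating binomials and their resolvent *)

Lemma expr_odd (K : fieldType) (x : K) n : x ^+ (2 * n).+1 = x * (x ^+ n) ^+ 2.
Proof. by rewrite exprS mulnC exprM. Qed.

(** The diagonal entry gamma_(2k+1) without its lambda part. *)
Definition eigval (K : fieldType) (Q t : K) (k : nat) : K :=
  Q ^+ (2 * k).+1 / t + t / Q ^+ (2 * k).+1.

(** The product of the A_l - z for l < i, multiplied by (- lambda)^i. *)
Definition eig_denom (K : fieldType) (Q t : K) (i : nat) : {poly K} :=
  \prod_(0 <= l < i) (1 - eigval Q t l *: 'X + 'X^2).

Ltac brace_side h :=
  apply: (brace_num h); [by rewrite ?mulf_neq0 ?expf_neq0 | ring].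

Section RowIdentities.
Variable K : fieldType.
Variables q t : K.
Hypothesis q0 : q != 0.
Hypothesis t0 : t != 0.
Hypothesis q1 : forall n, (0 < n)%N -> q ^+ n != 1.

Local Notation Q := (q ^+ 2).

Lemma Q_neq0 : Q != 0. Proof. by rewrite expf_neq0. Qed.

Lemma Q_neq1 n : (0 < n)%N -> Q ^+ n != 1.
Proof. by move=> n0; rewrite -exprM q1 // muln_gt0. Qed.

(** The first row of the matrix on the odd columns, divided by {2j+1}!: the
    normalization in which passing from j to j - 1 involves no further
    factor. *)
Definition alpha_row (j k : nat) : K :=
  (-1) ^+ (j + k) * brace_fact_inv Q j k / brace_fact Q (j + k).+1.

(** The factor of index l + 1 in the product of the closed formula. *)
Definition step_coef (l : nat) : K :=
  (q ^+ (2 * l).+1 / t - t / q ^+ (2 * l).+1) / brace q (2 * l).+1.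

Lemma alpha_row_gt j k : (j < k)%N -> alpha_row j k = 0.
Proof. by move=> jk; rewrite /alpha_row /brace_fact_inv leqNgt jk mulr0 mul0r. Qed.

(** Telescoping: the right-hand side W(k) satisfies
    W(k) - W(k+1) = (q^(2k+1) + q^-(2k+1)) a_j(k), which comes down to
    {j+k+1} + {j-k} = (q^(2j+1) - q^-(2j+1)) (q^(2k+1) + q^-(2k+1)), and W
    vanishes beyond j. *)
Lemma alpha_row_tail j k n : (j < n)%N -> (k <= n)%N ->
  \sum_(k <= l < n) (q ^+ (2 * l).+1 + q ^- (2 * l).+1) * alpha_row j l =
  (-1) ^+ (j + k) * brace_fact_inv Q j k / brace_fact Q (j + k) /
    brace q (2 * j).+1.
Proof.
move=> jn kn; pose W l := - ((-1) ^+ (j + l) * brace_fact_inv Q j l /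
  brace_fact Q (j + l) / brace q (2 * j).+1).
rewrite (telescope_sumr_eq W) //.
  by rewrite /W {1}/brace_fact_inv leqNgt jn /= mulr0 !mul0r oppr0 sub0r opprK.
move=> l _; rewrite /W /alpha_row brace_fact_invS ?Q_neq0 //; last exact: Q_neq1.
have := brace_fact_neq0 Q_neq0 Q_neq1 (j + l).
have := brace_neq0 Q_neq0 Q_neq1 (ltn0Sn (j + l)).
have := brace_neq0 q0 q1 (ltn0Sn (2 * j)).
rewrite addnS brace_factS.
move: (brace_fact_inv _ _ _) (brace_fact _ _) => r s.
rewrite /brace !expr_odd ?(exprS Q) ?(exprS (-1)) !exprD !(exprAC _ 2).
have := expf_neq0 j q0; have := expf_neq0 l q0.
move: (q ^+ j) (q ^+ l) ((-1) ^+ j) ((-1) ^+ l) => x y e f y0 x0 h1 h2 h3.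
field; do ?[apply/andP; split] => //.
all: solve [brace_side h1 | brace_side h2].
Qed.

(** Another telescoping sum, with primitive proportional to
    {l} (-1)^l / ({m-l}! {m+l}!): the relevant identity is
    {l}{m+l+1} + {l+1}{m-l} = {2l+1}{m}, and the division by {m} is where
    m > 0 is used.  The primitive vanishes at both ends. *)
Lemma alpha_row_beta m n : (0 < m < n)%N ->
  \sum_(0 <= l < n) alpha_row m l * brace Q (2 * l).+1 = 0.
Proof.
case/andP=> m0 mn; pose W l := - ((-1) ^+ (m + l) * brace_fact_inv Q m l /
  brace_fact Q (m + l) * (Q ^+ l - Q ^- l) / brace Q m).
rewrite (telescope_sumr_eq W) //.
  by rewrite /W {1}/brace_fact_inv leqNgt mn expr0 invr1 subrr !(mul0r, mulr0) oppr0 subrr.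
move=> l _; rewrite /W /alpha_row brace_fact_invS ?Q_neq0 //; last exact: Q_neq1.
have := brace_fact_neq0 Q_neq0 Q_neq1 (m + l).
have := brace_neq0 Q_neq0 Q_neq1 (ltn0Sn (m + l)).
have := brace_neq0 Q_neq0 Q_neq1 m0.
rewrite addnS brace_factS.
move: (brace_fact_inv _ _ _) (brace_fact _ _) => r s.
rewrite /brace !expr_odd ?(exprS Q) ?(exprS (-1)) !exprD !(exprAC _ 2).
have := expf_neq0 m q0; have := expf_neq0 l q0.
move: (q ^+ m) (q ^+ l) ((-1) ^+ m) ((-1) ^+ l) => x y e f y0 x0 h1 h2 h3.
field; do ?[apply/andP; split] => //.
all: solve [brace_side h1 | brace_side h2].
Qed.

(** After [alpha_row_tail] everything is proportional to a_j(k); the factor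
    A_k - A_j contains {j-k}, which turns 1/{j-k}! into 1/{j-k-1}!. *)
Lemma alpha_row_mul_tail j k n : (j < n)%N -> (k < n)%N ->
  alpha_row j k * eigval Q t k - (t - t^-1) * brace q (2 * k).+1 *
    (\sum_(k.+1 <= l < n) (q ^+ (2 * l).+1 + q ^- (2 * l).+1) * alpha_row j l) =
  eigval Q t j * alpha_row j k -
  step_coef j * (-1) ^+ (j + k) * brace_fact_inv Q j k.+1 / brace_fact Q (j + k).
Proof.
move=> jn kn; rewrite alpha_row_tail // /alpha_row /eigval /step_coef.
rewrite brace_fact_invS ?Q_neq0 //; last exact: Q_neq1.
have := brace_fact_neq0 Q_neq0 Q_neq1 (j + k).
have := brace_neq0 Q_neq0 Q_neq1 (ltn0Sn (j + k)).
have := brace_neq0 q0 q1 (ltn0Sn (2 * j)).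
rewrite addnS brace_factS.
move: (brace_fact_inv _ _ _) (brace_fact _ _) => r s.
rewrite /brace !expr_odd ?(exprS Q) ?(exprS (-1)) !exprD !(exprAC _ 2).
have := expf_neq0 j q0; have := expf_neq0 k q0.
move: (q ^+ j) (q ^+ k) ((-1) ^+ j) ((-1) ^+ k) => x y e f y0 x0 h1 h2 h3.
field; do ?[apply/andP; split] => //.
all: solve [brace_side h1 | brace_side h2].
Qed.

(** The left-hand side is entry k of the row a_j M, M being the matrix that
    has the A_k on its diagonal and the negatives of the summed coefficients
    below it. *)
Lemma alpha_row_bidiagonal j k n : (j < n)%N -> (k < n)%N ->
  alpha_row j k * eigval Q t k -
    \sum_(k.+1 <= l < n) (t - t^-1) * brace q (2 * k).+1 *
       (q ^+ (2 * l).+1 + q ^- (2 * l).+1) * alpha_row j l =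
  eigval Q t j * alpha_row j k +
  (if j is j'.+1 then step_coef j * alpha_row j' k else 0).
Proof.
move=> jn kn; under eq_bigr do rewrite -(mulrA ((t - t^-1) * _)).
rewrite -mulr_sumr alpha_row_mul_tail //; congr (_ + _).
case: j jn => [|j] jn; first by rewrite /brace_fact_inv mulr0 mul0r oppr0.
rewrite /alpha_row !addSn exprS /brace_fact_inv subSS ltnS; ring.
Qed.

Variables (F : fieldType) (phi : {rmorphism K -> F}) (z : F).
Hypothesis eig_neq : forall k, phi (eigval Q t k) - z != 0.

(** The row - a_j (M - z)^-1.  The recursion is the relation
    a_j M = A_j a_j + c_j a_(j-1), solved for a_j (M - z)^-1. *)
Fixpoint resolvent_row (j k : nat) : F :=
  - (phi (alpha_row j k) +
     (if j is j'.+1 then phi (step_coef j) * resolvent_row j' k else 0)) /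
    (phi (eigval Q t j) - z).

Arguments resolvent_row : simpl never.

Lemma resolvent_row0 k :
  resolvent_row 0 k = - phi (alpha_row 0 k) / (phi (eigval Q t 0) - z).
Proof. by rewrite /resolvent_row addr0. Qed.

Lemma resolvent_rowS j k : resolvent_row j.+1 k =
  - (phi (alpha_row j.+1 k) + phi (step_coef j.+1) * resolvent_row j k) /
    (phi (eigval Q t j.+1) - z).
Proof. by []. Qed.

Lemma resolvent_row_gt j k : (j < k)%N -> resolvent_row j k = 0.
Proof.
elim: j => [|j IH] jk.
  by rewrite resolvent_row0 alpha_row_gt // rmorph0 oppr0 mul0r.
by rewrite resolvent_rowS alpha_row_gt // rmorph0 IH ?(ltnW jk) // mulr0 addr0 oppr0 mul0r.
Qed.

(** The equation u_j (M - z) = - a_j, entry by entry. *)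
Lemma resolvent_rowP j k n : (j < n)%N -> (k < n)%N ->
  resolvent_row j k * (phi (eigval Q t k) - z) -
    \sum_(k.+1 <= l < n) phi ((t - t^-1) * brace q (2 * k).+1 *
       (q ^+ (2 * l).+1 + q ^- (2 * l).+1)) * resolvent_row j l =
  - phi (alpha_row j k).
Proof.
move=> jn kn; pose T l :=
  (t - t^-1) * brace q (2 * k).+1 * (q ^+ (2 * l).+1 + q ^- (2 * l).+1).
have eig_phi i : (i < n)%N ->
    phi (alpha_row i k) * phi (eigval Q t k) -
      \sum_(k.+1 <= l < n) phi (T l) * phi (alpha_row i l) =
    phi (eigval Q t i) * phi (alpha_row i k) +
      phi (if i is i'.+1 then step_coef i * alpha_row i' k else 0).
  move=> lt_in; rewrite -!(rmorphM phi) -rmorphD -(alpha_row_bidiagonal lt_in kn).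
  rewrite rmorphB rmorph_sum; congr (_ - _).
  by apply: eq_bigr => l _; rewrite [RHS]rmorphM.
elim: j jn => [|j IH] jn; have := eig_phi _ jn.
  rewrite rmorph0 addr0; set S := \sum_(_ <= _ < _) _ => e.
  have D0 := eig_neq 0; rewrite resolvent_row0.
  under eq_bigr do rewrite resolvent_row0 mulNr mulrN mulrA.
  rewrite sumrN -mulr_suml -/S.
  have -> : S = phi (alpha_row 0 k) * (phi (eigval Q t k) - phi (eigval Q t 0)).
    by rewrite mulrBr -[_ * phi (eigval Q t k)](subrK S) e; ring.
  by field.
rewrite (rmorphM phi (step_coef _)); set S := \sum_(_ <= _ < _) _ => e.
have := IH (ltnW jn); set S1 := \sum_(_ <= _ < _) _ => e1.
have D0 := eig_neq j.+1.
rewrite resolvent_rowS.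
have -> : \sum_(k.+1 <= l < n) phi (T l) * resolvent_row j.+1 l =
    - (S + phi (step_coef j.+1) * S1) / (phi (eigval Q t j.+1) - z).
  rewrite mulr_sumr -big_split /= mulNr mulr_suml -sumrN.
  by apply: eq_bigr => l _; rewrite resolvent_rowS -/(T l); ring.
have -> : S = phi (alpha_row j.+1 k) * (phi (eigval Q t k) - phi (eigval Q t j.+1)) -
    phi (step_coef j.+1) * phi (alpha_row j k).
  rewrite mulrBr -[_ * phi (eigval Q t k)](subrK S) e; ring.
have -> : S1 = resolvent_row j k * (phi (eigval Q t k) - z) + phi (alpha_row j k).
  by rewrite -[resolvent_row j k * _](subrK S1) e1; ring.
by field.
Qed.

(** All a_m with m > 0 are orthogonal to beta, so each step of the recursion
    only multiplies the pairing with beta by - c_j / (A_j - z). *)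
Lemma resolvent_row_beta j n : (j < n)%N ->
  \sum_(0 <= l < n) resolvent_row j l * phi (brace Q (2 * l).+1) =
  (-1) ^+ j.+1 * phi (\prod_(0 <= l < j) step_coef l.+1) /
   \prod_(0 <= l < j.+1) (phi (eigval Q t l) - z).
Proof.
elim: j => [|j IH] jn.
  rewrite (big_ltn jn).
  rewrite big1_seq => [|l]; last first.
    by rewrite mem_index_iota => /andP[_ /andP[l0 _]]; rewrite resolvent_row_gt ?mul0r.
  rewrite !big_nat1 (_ : \prod_(0 <= l < 0) _ = 1) ?big_geq // rmorph1 resolvent_row0.
  have -> : alpha_row 0 0 = (brace Q 1)^-1.
    rewrite /alpha_row /brace_fact_inv subnn brace_factS /brace_fact big_geq //.
    by rewrite expr0 invr1 !mul1r.
  have b0 : phi (brace Q 1) != 0.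
    by rewrite fmorph_eq0 (brace_neq0 Q_neq0 Q_neq1).
  by rewrite fmorphV muln0; field; rewrite eig_neq.
have -> : \sum_(0 <= l < n) resolvent_row j.+1 l * phi (brace Q (2 * l).+1) =
    - (phi (\sum_(0 <= l < n) alpha_row j.+1 l * brace Q (2 * l).+1) +
       phi (step_coef j.+1) *
         \sum_(0 <= l < n) resolvent_row j l * phi (brace Q (2 * l).+1)) /
    (phi (eigval Q t j.+1) - z).
  rewrite rmorph_sum mulr_sumr -big_split /= mulNr mulr_suml -sumrN.
  by apply: eq_bigr => l _; rewrite resolvent_rowS (rmorphM phi (alpha_row _ _)); ring.
rewrite alpha_row_beta // rmorph0 add0r IH ?(ltnW jn) //.
rewrite [\prod_(0 <= l < j.+2) _]big_nat_recr //=.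
rewrite [\prod_(0 <= l < j.+1) step_coef _]big_nat_recr //=.
rewrite (rmorphM phi _ (step_coef _)) (exprS _ j.+1) invfM; ring.
Qed.

End RowIdentities.

(** * Evaluation of the determinant *)

Lemma quad_coef0 (K : fieldType) (a : K) : (1 - a *: 'X + 'X^2 : {poly K})`_0 = 1.
Proof. by rewrite !(coefD, coefN, coefZ, coefX, coefXn, coef1) /= mulr0 oppr0 !addr0. Qed.

Lemma sub_add_inv (F : fieldType) (a l : F) : l != 0 ->
  a - (l + l^-1) = - (1 - a * l + l ^+ 2) / l.
Proof. by move=> l0; field. Qed.

Lemma prod_neg_div (F : fieldType) (d : nat -> F) (l : F) n :
  \prod_(0 <= k < n) (- d k / l) =
  (-1) ^+ n * \prod_(0 <= k < n) d k / l ^+ n.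
Proof.
elim: n => [|n IH]; first by rewrite !big_geq // !expr0 invr1 !mulr1.
by rewrite !big_nat_recr //= IH !exprS invfM; ring.
Qed.

Lemma sign_fraction (F : fieldType) (a p d l : F) n :
  a * ((-1) ^+ n * p / ((-1) ^+ n * d / l)) = a * p * l / d.
Proof.
have s0 : (-1) ^+ n != 0 :> F by rewrite expf_neq0 // oppr_eq0 oner_eq0.
by rewrite !invfM invrK -[a * p * l]mulr1 -[X in _ = _ * X / _](mulfV s0); ring.
Qed.

Section Determinant.
Variable K : fieldType.
Variables q t : K.
Hypothesis q0 : q != 0.
Hypothesis t0 : t != 0.
Hypothesis q1 : forall n, (0 < n)%N -> q ^+ n != 1.

Local Notation Q := (q ^+ 2).
Local Notation ratfun := {fraction {poly K}}.
Local Notation phi := (@tofrac {poly K} \o @polyC K : {rmorphism K -> ratfun}).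
Local Notation lambda := (tofrac 'X : ratfun).
Let Q0 := Q_neq0 q0.
Let Q1 := Q_neq1 q1.

Lemma cyclo_alphaE j m : (m <= j)%N ->
  cyclo_alpha q j.+1 m.+1 = brace_fact Q (2 * j).+1 * alpha_row q j m.
Proof.
move=> mj; rewrite /cyclo_alpha /alpha_row /brace_fact_inv mj subSS qbinomE //; last by lia.
have -> : (2 * j.+1 - 1 = (2 * j).+1)%N by lia.
have -> : ((2 * j).+1 - (j - m) = (j + m).+1)%N by lia.
have -> : (-1) ^+ (j - m) = (-1) ^+ (j + m) :> K.
  by rewrite -signr_odd oddB // -oddD signr_odd.
rewrite invfM; ring.
Qed.

Lemma cyclo_bE k m : (m < k)%N ->
  cyclo_b q t 1 (2 * k).+1 (2 * m).+1 =
  - ((t - t^-1) * brace q (2 * m).+1 * (q ^+ (2 * k).+1 + q ^- (2 * k).+1)).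
Proof.
move=> mk; rewrite /cyclo_b subSS -mulnBr oddM /= expr1.
have -> : (2 * k).+1%:Z + (2 * m).+1%:Z = ((2 * k).+1 + (2 * m).+1)%N by lia.
have -> : (2 * k).+1%:Z - (2 * m).+1%:Z = (2 * k - 2 * m)%N :> int by lia.
rewrite !qbraceE /brace.
have e : q ^+ (2 * k).+1 = q ^+ (2 * k - 2 * m) * q ^+ (2 * m).+1.
  by rewrite -exprD; congr (_ ^+ _); lia.
rewrite exprD e; have := expf_neq0 (2 * m).+1 q0; have := expf_neq0 (2 * k - 2 * m) q0.
move: (q ^+ (2 * m).+1) (q ^+ (2 * k - 2 * m)) => x y x0 y0.
by field; rewrite x0 y0 t0.
Qed.

(** Here the second parameter is 1, so that t_2 - t_2^-1 = 0: odd rows do not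
    meet even columns. *)
Lemma cyclo_b_parity k m : (m <= k)%N -> cyclo_b q t 1 (2 * k).+1 (2 * m) = 0.
Proof.
by move=> mk; rewrite /cyclo_b subSn ?leq_mul2l //= -mulnBr oddM /= invr1 subrr mulr0.
Qed.

Lemma cyclo_gammaE k :
  cyclo_gamma q t (2 * k).+1 = phi (eigval Q t k) - (lambda + lambda^-1).
Proof.
rewrite /cyclo_gamma /eigval exprM opprD addrA /=.
by rewrite [_^-1 * t]mulrC.
Qed.

Lemma cst_sub_lambda (a : K) :
  tofrac a%:P - (lambda + lambda^-1) = - tofrac (1 - a *: 'X + 'X^2) / lambda.
Proof.
have l0 : lambda != 0 by rewrite tofrac_eq0 polyX_eq0.
rewrite -mul_polyC !(rmorphD, rmorphN, rmorphM, rmorph1, rmorphXn) /=.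
exact: sub_add_inv.
Qed.

Lemma cst_sub_lambda_neq0 (a : K) : tofrac a%:P - (lambda + lambda^-1) != 0.
Proof.
have l0 : lambda != 0 by rewrite tofrac_eq0 polyX_eq0.
rewrite cst_sub_lambda; apply: mulf_neq0; last by rewrite invr_eq0.
rewrite oppr_eq0 tofrac_eq0.
by apply: contra_neq (oner_neq0 K) => e; rewrite -(quad_coef0 a) e coef0.
Qed.

Lemma cyclo_gamma_neq0 N : cyclo_gamma q t N != 0.
Proof. rewrite /cyclo_gamma -addrA -opprD; exact: cst_sub_lambda_neq0. Qed.

Lemma sum_even_odd (V : nmodType) (G : nat -> V) n :
  \sum_(0 <= p < 2 * n) G p = \sum_(0 <= k < n) (G (2 * k)%N + G (2 * k).+1).
Proof.
elim: n => [|n IH]; first by rewrite !big_geq.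
by rewrite mulnS !big_nat_recr //= IH addrA.
Qed.

(** The entries as a function of natural numbers, which lets the sums over
    rows be cut and reindexed. *)
Definition cyclo_entry (i p N : nat) : ratfun :=
  if p == 0%N then
    if odd N then tofrac (cyclo_alpha q i N.+1./2)%:P else 0
  else if N == 0%N then tofrac (cyclo_beta q p)%:P
  else if (N < p)%N then tofrac (cyclo_b q t 1 p N)%:P
  else if N == p then cyclo_gamma q t p
  else 0.

Lemma cyclo_mxE i : cyclo_mx q t 1 i = \matrix_(p, N) cyclo_entry i p N.
Proof. by apply/matrixP => p N; rewrite !mxE. Qed.

Lemma eig_lambda_neq0 k : phi (eigval Q t k) - (lambda + lambda^-1) != 0.
Proof. exact: cst_sub_lambda_neq0. Qed.

Local Notation u := (resolvent_row q t phi (lambda + lambda^-1)).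

(** The coefficients of the row operation that clears the first row of the
    matrix outside its first column: a multiple of the resolvent row on the odd
    indices, and 0 on the even ones. *)
Definition elim_row (j p : nat) : ratfun :=
  if p == 0%N then 1
  else if odd p then phi (brace_fact Q (2 * j).+1) * u j p./2 else 0.

Lemma elim_row_sum j (G : nat -> ratfun) :
  \sum_(0 <= p < 2 * j.+1) elim_row j p * G p =
  G 0%N + phi (brace_fact Q (2 * j).+1) * \sum_(0 <= k < j.+1) u j k * G (2 * k).+1.
Proof.
rewrite sum_even_odd big_split /=; congr (_ + _).
  rewrite big_nat_recl // big1 => [|k _]; first by rewrite addr0 /elim_row mul1r.
  by rewrite /elim_row mul2n double_eq0 odd_double mul0r.
rewrite big_distrr /=; apply: eq_bigr => k _.
by rewrite /elim_row mul2n /= odd_double uphalf_double mulrA.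
Qed.

(** For N even the alphas and, by parity, the entries below vanish; for N odd
    this is the defining equation of the resolvent row. *)
Lemma elim_row_kills j N : (0 < N < 2 * j.+1)%N ->
  \sum_(0 <= p < 2 * j.+1) elim_row j p * cyclo_entry j.+1 p N = 0.
Proof.
case/andP=> N0 Nj; rewrite elim_row_sum.
have [m [b eN]] : exists m b, N = (b + 2 * m)%N :> nat /\ (b < 2)%N.
  by exists N./2, (odd N); rewrite mul2n odd_double_half; case: (odd N).
case: b eN => [|[|b]] [eN] // _; rewrite {}eN in N0 Nj *.
  rewrite add0n {1}/cyclo_entry /= oddM /= add0r big1 ?mulr0 // => k _.
  rewrite /cyclo_entry /= (gtn_eqF N0).
  case: ltngtP => [mk|_|e]; rewrite ?mulr0 //; last by lia.
  by rewrite cyclo_b_parity ?polyC0 ?tofrac0 ?mulr0 //; lia.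
have mj : (m < j.+1)%N by lia.
rewrite add1n {1}/cyclo_entry /= oddM /= (_ : (2 * m)./2 = m); last by lia.
rewrite cyclo_alphaE // polyCM tofracM -mulrDr.
apply/eqP; rewrite mulf_eq0; apply/orP; right; apply/eqP.
rewrite (big_cat_nat (n := m)) ?(ltnW mj) //=.
rewrite big_nat big1 ?add0r => [|k /andP[_ km]]; last first.
  rewrite /cyclo_entry /= ltnS ltn_mul2l /= (ltnNge m) (ltnW km) /= eqSS eqn_mul2l /=.
  by rewrite (gtn_eqF km) mulr0.
rewrite big_ltn // {1}/cyclo_entry /= ltnn eqxx cyclo_gammaE.
have := resolvent_rowP q0 t0 q1 eig_lambda_neq0 (ltnSn j) mj.
move=> /(canRL (subrK _)) ->.
rewrite addrA [X in X + _]addrA /= subrr add0r -big_split big_nat big1 // => k /andP[mk _].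
rewrite /cyclo_entry /= ltnS ltn_mul2l /= mk cyclo_bE //.
by rewrite polyCN tofracN mulrN [X in _ - X]mulrC subrr.
Qed.

Lemma elim_row_first j :
  \sum_(0 <= p < 2 * j.+1) elim_row j p * cyclo_entry j.+1 p 0 =
  phi (brace_fact Q (2 * j).+1 / brace Q 1) *
   \sum_(0 <= l < j.+1) u j l * phi (brace Q (2 * l).+1).
Proof.
rewrite elim_row_sum add0r rmorphM -mulrA; congr (_ * _).
rewrite big_distrr /=; apply: eq_bigr => k _.
by rewrite /cyclo_entry /= /cyclo_beta /qint !qbraceE polyCM tofracM mulrA [RHS]mulrC.
Qed.

(** Replacing the first row by the combination given by [elim_row] does not
    change the determinant, since the first row enters it with coefficient 1, and
    leaves a lower triangular matrix. *)
Lemma det_cyclo_mx j :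
  \det (cyclo_mx q t 1 j.+1) = phi (brace_fact Q (2 * j).+1 / brace Q 1) *
   (\sum_(0 <= l < j.+1) u j l * phi (brace Q (2 * l).+1)) *
   \prod_(1 <= N < 2 * j.+1) cyclo_gamma q t N.
Proof.
have n0 : (0 < 2 * j.+1)%N by [].
(* The identity matrix with its first row replaced by the row operation. *)
pose V : 'M[ratfun]_(2 * j.+1) :=
  \matrix_(p, N) if p == 0%N :> nat then elim_row j N else (p == N)%:R.
have detV : \det V = 1.
  rewrite -det_tr det_trig; last first.
    by apply/is_trig_mxP => p N pN; rewrite !mxE
      (gtn_eqF (leq_ltn_trans _ pN)) // -val_eqE /= gtn_eqF.
  by apply: big1 => p _; rewrite !mxE eqxx; case: eqP => // ->.
have VB p N : (V *m cyclo_mx q t 1 j.+1) p N =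
    if p == 0%N :> nat then
      \sum_(0 <= r < 2 * j.+1) elim_row j r * cyclo_entry j.+1 r N
    else cyclo_entry j.+1 p N.
  rewrite cyclo_mxE mxE; case: ifP => p0.
    by rewrite big_mkord; apply: eq_bigr => r _; rewrite !mxE p0.
  rewrite (bigD1 p) //= !mxE p0 eqxx mul1r big1 ?addr0 // => r rp.
  by rewrite !mxE p0 eq_sym (negbTE rp) mul0r.
have -> : \det (cyclo_mx q t 1 j.+1) = \det (V *m cyclo_mx q t 1 j.+1).
  by rewrite det_mulmx detV mul1r.
rewrite det_trig; last first.
  apply/is_trig_mxP => p N pN; rewrite VB; case: eqP => p0.
    by rewrite elim_row_kills // -{1}p0 pN ltn_ord.
  rewrite /cyclo_entry; move/eqP/negbTE: (p0) => ->.
  by rewrite (gtn_eqF (leq_ltn_trans _ pN)) // ltnNge (ltnW pN) /= gtn_eqF.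
transitivity (\prod_(0 <= p < 2 * j.+1)
   (if p == 0%N then \sum_(0 <= r < 2 * j.+1) elim_row j r * cyclo_entry j.+1 r 0
    else cyclo_gamma q t p)).
  rewrite big_mkord; apply: eq_bigr => p _; rewrite VB; case: eqP => [->//|/eqP/negbTE p0].
  by rewrite /cyclo_entry p0 ltnn eqxx.
rewrite big_ltn //= elim_row_first; congr (_ * _).
by apply: eq_big_nat => p /andP[p0 _]; rewrite gtn_eqF.
Qed.

(** As A_l - z = - (1 - A_l lambda + lambda^2) / lambda, the signs cancel and
    the powers of lambda move to the numerator. *)
Lemma cyclo_ratio j :
  \det (cyclo_mx q t 1 j.+1) / \prod_(1 <= N < 2 * j.+1) cyclo_gamma q t N =
  tofrac ((brace_fact Q (2 * j).+1 / brace Q 1 *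
            \prod_(0 <= l < j) step_coef q t l.+1) *: 'X^(j.+1)) /
  tofrac (eig_denom Q t j.+1).
Proof.
rewrite det_cyclo_mx mulfK; last first.
  by rewrite prodf_seq_neq0; apply/allP => N _; rewrite cyclo_gamma_neq0.
rewrite (resolvent_row_beta q0 q1 eig_lambda_neq0) //.
have -> : \prod_(0 <= l < j.+1) (phi (eigval Q t l) - (lambda + lambda^-1)) =
    (-1) ^+ j.+1 * tofrac (eig_denom Q t j.+1) / lambda ^+ j.+1.
  under eq_bigr do rewrite /= cst_sub_lambda.
  rewrite prod_neg_div; congr (_ * _ / _).
  by rewrite /eig_denom rmorph_prod.
rewrite sign_fraction -mul_polyC polyCM !tofracM; congr (_ * _ / _).
by rewrite tofracXn.
Qed.
End Determinant.

(** * The reciprocal power series and dilations of the variable *)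

Section Reciprocal.
Variable K : fieldType.
Implicit Types (c : K) (p D : {poly K}).

Definition dilate c p : {poly K} := p \Po (c *: 'X).

Lemma coef_dilate c p m : (dilate c p)`_m = c ^+ m * p`_m.
Proof.
rewrite /dilate coef_comp_poly.
under eq_bigr do rewrite exprZn coefZ coefXn.
case: (ltnP m (size p)) => mp.
  rewrite (bigD1 (Ordinal mp)) //= eqxx mulr1 mulrC big1 ?addr0 // => k km.
  by move: km; rewrite -val_eqE eq_sym /= => /negbTE ->; rewrite !mulr0.
rewrite nth_default // mulr0 big1 // => k _.
by rewrite gtn_eqF ?mulr0 // (leq_trans (ltn_ord k)).
Qed.

Lemma dilateM c p1 p2 : dilate c (p1 * p2) = dilate c p1 * dilate c p2.
Proof. exact: rmorphM. Qed.

Definition series_trunc D n : {poly K} := \poly_(j < n.+1) quot_coef 1 D j.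

(** Truncation makes 1 / D a polynomial that inverts D modulo 'X^(n+1), which
    is all that a statement about the coefficient of index n needs. *)
Lemma series_truncP D n : D`_0 != 0 ->
  exists R : {poly K}, D * series_trunc D n = 1 + R * 'X^(n.+1).
Proof.
move=> D0; exists (drop_poly n.+1 (D * series_trunc D n)).
rewrite -[LHS](poly_take_drop n.+1); congr (_ + _).
apply/polyP => m; rewrite coef_take_poly; case: ifP => mn; last first.
  by rewrite coef1; case: m mn.
rewrite -(quot_coefP 1 m D0) coefMr; apply: eq_bigr => k _.
by rewrite coef_poly (leq_trans (ltn_ord k)).
Qed.

(** With G = 1 / D, the hypothesis reads E(X) G(cX) = E'(X) G(c'X): both sides
    are multiplied by D(cX) D(c'X), which is invertible as a power series. *)
Lemma dilate_reciprocal c c' D E E' n : D`_0 != 0 ->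
  dilate c D * E' = dilate c' D * E ->
  (E * dilate c (series_trunc D n))`_n = (E' * dilate c' (series_trunc D n))`_n.
Proof.
move=> D0 eqDE; have [R eR] := series_truncP n D0.
have dX a : exists S : {poly K}, dilate a D * dilate a (series_trunc D n) = 1 + S * 'X^(n.+1).
  exists (a ^+ n.+1 *: dilate a R); rewrite -dilateM eR /dilate.
  rewrite rmorphD rmorphM rmorph1 rmorphXn /= comp_polyX exprZn.
  by rewrite -scalerAl scalerAr.
have [S eS] := dX c; have [S' eS'] := dX c'.
set G := dilate c (series_trunc D n) in eS *.
set G' := dilate c' (series_trunc D n) in eS' *.
have e : E * G - E' * G' = (E' * G' * S - E * G * S') * 'X^(n.+1).
  have e1 : E * G * (dilate c' D * G') = E' * G' * (dilate c D * G).
    have -> : E * G * (dilate c' D * G') = (dilate c' D * E) * G * G' by ring.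
    by rewrite -eqDE; ring.
  move: e1; rewrite eS eS' => /eqP; rewrite -subr_eq0 => /eqP e1.
  by apply/eqP; rewrite -subr_eq0 -[X in _ == X]e1; apply/eqP; ring.
apply/eqP; rewrite -subr_eq0 -coefB e coefMXn ltnSn //.
Qed.

Lemma mul_linear_quad (a b : K) :
  (1 - a *: 'X) * (1 - b *: 'X) = 1 - (a + b) *: 'X + (a * b) *: 'X^2 :> {poly K}.
Proof. by rewrite -!mul_polyC polyCD polyCM; ring. Qed.

Lemma coef_quadM (a b : K) p m :
  ((1 - a *: 'X + b *: 'X^2) * p)`_m.+2 = p`_m.+2 - a * p`_m.+1 + b * p`_m.
Proof.
by rewrite !mulrDl mul1r mulNr -!scalerAl !coefD coefN !coefZ coefXM coefXnM /= subn2.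
Qed.

Lemma coef_quadM1 (a b : K) p :
  ((1 - a *: 'X + b *: 'X^2) * p)`_1 = p`_1 - a * p`_0.
Proof.
by rewrite !mulrDl mul1r mulNr -!scalerAl !coefD coefN !coefZ coefXM coefXnM /= mulr0 addr0.
Qed.

End Reciprocal.

(** * Rogers polynomials *)

Section Rogers.
Variable K : fieldType.
Variable Q : K.
Hypothesis Q0 : Q != 0.
Hypothesis Q1 : forall n, (0 < n)%N -> Q ^+ n != 1.

(** The recurrence of the Rogers polynomials C_m(x; Q^(2i) | Q^2) with the
    powers of Q balanced, that is, of the coefficients of
    1 / prod_(l < i) (1 - x Q^(2l-i+1) lambda) (1 - x^-1 Q^(2l-i+1) lambda). *)
Definition rogers_rec (x : K) (i : nat) (g : nat -> K) :=
  [/\ g 0%N = 1,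
      brace Q 1 * g 1%N = (x + x^-1) * brace Q i &
      forall m, brace Q m.+2 * g m.+2 =
        (x + x^-1) * brace Q (m.+1 + i) * g m.+1 - brace Q (m + 2 * i) * g m].

(** The monic polynomials p_m and the Rogers polynomials g_m differ by the
    ratio of the leading coefficients, which the two recurrences determine. *)
Lemma macdonald_rogers x i g m : (0 < i)%N -> rogers_rec x i g ->
  macdonald m x Q (Q ^+ i) * \prod_(0 <= k < m) brace Q (k + i) =
  g m * brace_fact Q m.
Proof.
move=> i0 [g0 g1 gS].
suff /(_ m)[] : forall m,
  macdonald m x Q (Q ^+ i) * \prod_(0 <= k < m) brace Q (k + i) = g m * brace_fact Q m /\
  macdonald m.+1 x Q (Q ^+ i) * \prod_(0 <= k < m.+1) brace Q (k + i) =
    g m.+1 * brace_fact Q m.+1 by [].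
elim=> [|{}m [IH1 IH2]].
  rewrite (big_geq (leqnn 0)) big_nat1 /macdonald /= hornerC hornerX g0 brace_factS brace_fact0.
  by rewrite mulr1 mul1r add0n [g _ * _]mulrC g1; split.
split=> //; have recE : macdonald_rec Q (Q ^+ i) m.+1 =
    brace Q m.+1 / brace Q (m.+1 + i) * (brace Q (m + 2 * i) / brace Q (m + i)).
  rewrite /macdonald_rec /brace (addnC m.+1 i) (addnC m i) (addnC m (2 * i)%N) (mulnC 2%N i).
  by rewrite !(exprD _ i) (exprD _ (i * 2)) exprM !invfM.
have -> : macdonald m.+2 x Q (Q ^+ i) =
    (x + x^-1) * macdonald m.+1 x Q (Q ^+ i) -
    macdonald_rec Q (Q ^+ i) m.+1 * macdonald m x Q (Q ^+ i).
  by rewrite /macdonald [macdonald_poly _ _ m.+2]/= !hornerE.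
have b1 := brace_neq0 Q0 Q1 (ltn_addl (m.+1) i0).
have b0 := brace_neq0 Q0 Q1 (ltn_addl m i0).
move: IH2; rewrite !(big_nat_recr m.+1) //= !(big_nat_recr m) //= => IH2.
rewrite recE (brace_factS _ m.+1) [in RHS]mulrCA [g _ * _]mulrC gS.
move: (macdonald m _ _ _) (macdonald m.+1 _ _ _) IH1 IH2 => M M1 IH1 IH2.
transitivity ((x + x^-1) * brace Q (m.+1 + i) *
    (M1 * (\prod_(0 <= k < m) brace Q (k + i) * brace Q (m + i))) -
  brace Q m.+1 * brace Q (m + 2 * i) * (M * \prod_(0 <= k < m) brace Q (k + i))).
  move: (brace Q (m.+1 + i)) b1 (brace Q (m + i)) b0 => B1 B1n B0 B0n.
  move: (\prod_(0 <= k < m) _) (x + x^-1) => P y.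
  by field; rewrite B1n B0n.
rewrite IH2 IH1 brace_factS; move: (x + x^-1) => y; ring.
Qed.

Lemma macdonald_ratio x i g g' m : (0 < i)%N ->
  rogers_rec x i g -> rogers_rec (Q ^+ i) i g' ->
  macdonald m x Q (Q ^+ i) / macdonald m (Q ^+ i) Q (Q ^+ i) = g m / g' m.
Proof.
move=> i0 /(macdonald_rogers m i0) e /(macdonald_rogers m i0) e'.
have P0 : \prod_(0 <= k < m) brace Q (k + i) != 0.
  by rewrite prodf_seq_neq0; apply/allP => k _; rewrite brace_neq0 ?ltn_addl.
have F0 := brace_fact_neq0 Q0 Q1 m.
rewrite -[LHS](mulr1) -(mulfV P0) mulrACA e -invfM e' invfM mulrACA mulfV // mulr1 //.
Qed.

(** The principal specialization: with {m+1+i}(Q^i + Q^-i) = {m+1+2i} + {m+1}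
    the three-term recurrence is satisfied by a solution of a two-term one. *)
Lemma rogers_rec_principal j :
  rogers_rec (Q ^+ j.+1) j.+1 (fun m =>
    brace_fact Q (m + (2 * j).+1) / (brace_fact Q m * brace_fact Q (2 * j).+1)).
Proof.
have b := brace_fact_neq0 Q0 Q1; have b1 n := brace_neq0 Q0 Q1 (ltn0Sn n).
have y0 : Q ^+ j.+1 != 0 by rewrite expf_neq0.
split=> [||m].
- by rewrite add0n brace_fact0 mul1r mulfV.
- rewrite add1n !brace_factS brace_fact0 mul1r.
  have -> : brace Q (2 * j).+2 = (Q ^+ j.+1 + (Q ^+ j.+1)^-1) * brace Q j.+1.
    have -> : ((2 * j).+2 = j.+1 + j.+1)%N by lia.
    by rewrite /brace exprD; field.
  move: (b (2 * j)%N) (b1 (2 * j)%N) (b1 0%N) y0 => h1 h2 h3 y0.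
  move: (brace_fact Q (2 * j)) h1 (brace Q (2 * j).+1) h2 (brace Q 1) h3 => F F0 B B0 B1 B10.
  by move: (Q ^+ j.+1) y0 (brace Q j.+1) => y y0 C; field; rewrite y0 F0 B0 B10.
have -> : (m + 2 * j.+1 = (m + (2 * j).+1).+1)%N by lia.
have e : brace Q (m + (2 * j).+1).+2 =
    (Q ^+ j.+1 + (Q ^+ j.+1)^-1) * brace Q (m.+1 + j.+1) - brace Q m.+1.
  have -> : ((m + (2 * j).+1).+2 = m.+1 + j.+1 + j.+1)%N by lia.
  rewrite /brace !exprD; have := expf_neq0 m.+1 Q0; move: y0.
  move: (Q ^+ j.+1) (Q ^+ m.+1) => y z y0 z0.
  by field; rewrite y0 z0.
rewrite ![(m.+2 + _)%N]addSn ![(m.+1 + (2 * j).+1)%N]addSn.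
rewrite !(brace_factS _ (m + _).+1) !(brace_factS _ (m + _)).
rewrite !(brace_factS _ m.+1) !(brace_factS _ m) {}e.
move: (b m) (b1 m) (b1 m.+1) (b (2 * j).+1) => h1 h2 h3 h4.
move: (brace_fact Q m) h1 (brace Q m.+1) h2 (brace Q m.+2) h3 => f f0 B B0 C C0.
move: (brace_fact Q (2 * j).+1) h4 (brace_fact Q (m + _)) => F F0 G.
move: (brace Q (m.+1 + _)) (brace Q (m + _).+1) (Q ^+ j.+1 + _) => x z y.
by field; rewrite f0 B0 C0 F0.
Qed.

Variable t : K.
Hypothesis t0 : t != 0.

(** The roots of 1 - A_l X + X^2 are Q^(2l+1)/t and its inverse; each dilation
    moves one linear factor up and the other one down, so that the factors of
    consecutive l match. *)
Lemma eigval_quad_dilate l :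
  dilate Q (1 - eigval Q t l *: 'X + 'X^2) =
    (1 - (Q ^+ (2 * l.+1) / t) *: 'X) * (1 - (t / Q ^+ (2 * l)) *: 'X) /\
  dilate Q^-1 (1 - eigval Q t l *: 'X + 'X^2) =
    (1 - (Q ^+ (2 * l) / t) *: 'X) * (1 - (t / Q ^+ (2 * l.+1)) *: 'X).
Proof.
have Qn n : Q ^+ n != 0 by rewrite expf_neq0.
have dil c : dilate c (1 - eigval Q t l *: 'X + 'X^2) =
    1 - (c * eigval Q t l) *: 'X + (c ^+ 2) *: 'X^2.
  rewrite /dilate !(rmorphD, rmorphN, rmorph1, rmorphXn) /= comp_polyZ comp_polyX.
  by rewrite exprZn scalerA mulrC.
have e2 : Q ^+ (2 * l.+1) = Q ^+ 2 * Q ^+ (2 * l) by rewrite -exprD mulnS.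
rewrite !dil !mul_linear_quad /eigval e2 (exprS _ (2 * l)); split; congr (_ - _ *: _ + _ *: _).
all: have := Qn (2 * l)%N; move: (Q ^+ (2 * l)) => y y0;
  by field; rewrite ?y0 ?Q0 ?t0.
Qed.

(** The two products over l share all linear factors but the extreme ones. *)
Lemma eig_denom_dilate i :
  dilate Q (eig_denom Q t i) *
    ((1 - t^-1 *: 'X) * (1 - (t / Q ^+ (2 * i)) *: 'X)) =
  dilate Q^-1 (eig_denom Q t i) *
    ((1 - (Q ^+ (2 * i) / t) *: 'X) * (1 - t *: 'X)).
Proof.
elim: i => [|i IH].
  by rewrite /eig_denom big_geq // /dilate !rmorph1 muln0 expr0 invr1 mulr1 mul1r.
rewrite /eig_denom big_nat_recr //= -/(eig_denom Q t i) !dilateM.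
have [-> ->] := eigval_quad_dilate i.
set a := 1 - (Q ^+ (2 * i.+1) / t) *: 'X; set b := 1 - (t / Q ^+ (2 * i.+1)) *: 'X.
transitivity (dilate Q (eig_denom Q t i) *
    ((1 - t^-1 *: 'X) * (1 - (t / Q ^+ (2 * i)) *: 'X)) * (a * b)); first by ring.
by rewrite IH; ring.
Qed.

Lemma eig_denom0 i : (eig_denom Q t i)`_0 = 1.
Proof.
elim: i => [|i IH]; first by rewrite /eig_denom big_geq ?coef1.
by rewrite /eig_denom big_nat_recr //= coef0M IH quad_coef0 mulr1.
Qed.

(** The coefficients of index m of the functional equation
    (1 - (x + x^-1) Q^i X + Q^(2i) X^2) G(QX) =
    (1 - (x + x^-1) Q^-i X + Q^(-2i) X^2) G(X/Q) with x = Q^i / t. *)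
Lemma rogers_rec_eig_denom i :
  rogers_rec (Q ^+ i / t) i (quot_coef 1 (eig_denom Q t i)).
Proof.
set D := eig_denom Q t i; have D0 : D`_0 != 0 by rewrite eig_denom0 oner_neq0.
have := eig_denom_dilate i; rewrite -/D !mul_linear_quad => e.
have key n := dilate_reciprocal n D0 e.
have trunc n k : (k <= n)%N -> (series_trunc D n)`_k = quot_coef 1 D k.
  by move=> kn; rewrite coef_poly ltnS kn.
have g0 : quot_coef 1 D 0 = 1.
  by have := quot_coefP 1 0 D0; rewrite big_ord1 subnn eig_denom0 mul1r coef1.
have y0 : Q ^+ i != 0 by rewrite expf_neq0.
have e2 : Q ^+ (2 * i) = Q ^+ i ^+ 2 by rewrite mulnC exprM.
rewrite /rogers_rec /brace; split=> // [|m].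
  have := key 1%N; rewrite !coef_quadM1 !coef_dilate !trunc // g0 e2 !expr1 !expr0.
  move: (Q ^+ i) y0 (quot_coef 1 D 1) => y y0 g1.
  move/eqP; rewrite -subr_eq0 => /eqP k0.
  apply/eqP; rewrite -subr_eq0 -[X in _ == X]k0; apply/eqP.
  by field; rewrite y0 Q0 t0.
have := key m.+2; rewrite !coef_quadM !coef_dilate.
rewrite (trunc m.+2 m) ?(trunc m.+2 m.+1) ?(trunc m.+2 m.+2) //; last by lia.
rewrite !exprVn addSn !(exprS Q (_ + _)).
rewrite !(exprS Q m.+1) !(exprS Q m).
rewrite (exprD _ m i) (exprD _ m (2 * i)) e2.
have := expf_neq0 m Q0; move: (Q ^+ i) y0 (Q ^+ m) => y y0 z z0.
move: (quot_coef _ _ _) (quot_coef _ _ _) (quot_coef _ _ _) => g2 g1 gm.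
move/eqP; rewrite -subr_eq0 => /eqP k0.
apply/eqP; rewrite -subr_eq0 -[X in _ == X]k0; apply/eqP.
by field; rewrite y0 Q0 t0 z0.
Qed.

End Rogers.

(** * The coefficients of the generating function *)

Lemma series_coef_monomial (K : fieldType) (c : K) (D : {poly K}) i n :
  D`_0 != 0 -> (i <= n)%N ->
  series_coef (tofrac (c *: 'X^i) / tofrac D) n = c * quot_coef 1 D (n - i).
Proof.
move=> D0 le_in.
rewrite (quot_coef_uniq D0 (fun m => series_coefP m D0 (erefl _))).
pose a m := if (m < i)%N then 0 else c * quot_coef 1 D (m - i).
rewrite -(@quot_coef_uniq _ _ _ a D0) /a; first by rewrite ltnNge le_in.
move=> m; rewrite coefZ coefXn -(big_mkord xpredT
  (fun k => D`_(m - k) * if (k < i)%N then 0 else c * quot_coef 1 D (k - i))).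
case: (ltnP m i) => [lt_mi|le_im].
  rewrite (ltn_eqF lt_mi) mulr0 big_nat big1 // => k /andP[_ km].
  by rewrite (leq_trans km lt_mi) mulr0.
rewrite (big_cat_nat (n := i)) ?leqW //=.
rewrite big_nat big1 ?add0r => [|k /andP[_ ->]]; last exact: mulr0.
rewrite -{1}[i]add0n big_addn subSn // big_mkord.
have -> : (m == i) = (m - i == 0)%N by lia.
rewrite -coef1 -(quot_coefP 1 (m - i) D0) big_distrr; apply: eq_bigr => k _ /=.
by rewrite addnK ltnNge leq_addl /= mulrCA subnDA subnAC.
Qed.

Section Main.
Variable K : fieldType.
Variables q t : K.
Hypothesis q0 : q != 0.
Hypothesis t0 : t != 0.
Hypothesis q1 : forall n, (0 < n)%N -> q ^+ n != 1.

Local Notation Q := (q ^+ 2).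
Let Q0 := Q_neq0 q0.
Let Q1 := Q_neq1 q1.

Lemma cyclo_coefE n j : (j < n)%N ->
  cyclo_coef q n j = brace_fact Q (n + j) / (brace Q 1 * brace_fact Q (n - j.+1)).
Proof.
move=> jn; rewrite /cyclo_coef.
have -> : \prod_(n - j <= p < (n + j).+1) (q ^+ (2 * p) - q ^- (2 * p)) =
    brace_fact Q (n + j) / brace_fact Q (n - j.+1).
  apply: (canRL (mulfK (brace_fact_neq0 Q0 Q1 _))).
  rewrite mulrC /brace_fact [RHS](big_cat_nat (n := (n - j.+1))) //=; last by lia.
  congr (_ * _); have -> : (n - j = (n - j.+1).+1)%N by lia.
  rewrite big_add1 /=.
  by apply: eq_bigr => p _; rewrite /brace exprM.
by rewrite mulrCA -invfM.
Qed.

Lemma prod_step_coef j :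
  \prod_(2 <= l < j.+2)
       ((q ^+ (2 * l - 1) * t^-1 - q ^- (2 * l - 1) * t) /
        (q ^+ (2 * l - 1) - q ^- (2 * l - 1))) =
  \prod_(0 <= l < j) step_coef q t l.+1.
Proof.
rewrite 2!big_add1 /=; apply: eq_bigr => l _; rewrite /step_coef /brace.
have -> : (2 * l.+2 - 1 = (2 * l.+1).+1)%N by lia.
by rewrite [_^-1 * t]mulrC.
Qed.

(** The formula over any field, for parameters that satisfy what is true of
    indeterminates: q and t are nonzero and q is not a root of unity. *)
Lemma gen_cyclo_coefE n j : (j < n)%N ->
  gen_cyclo_coef q t 1 n j =
    macdonald (n - j.+1) (q ^+ (2 * j.+1) * t^-1) Q (q ^+ (2 * j.+1)) /
    macdonald (n - j.+1) (q ^+ (2 * j.+1)) Q (q ^+ (2 * j.+1)) *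
    (\prod_(2 <= l < j.+2)
       ((q ^+ (2 * l - 1) * t^-1 - q ^- (2 * l - 1) * t) /
        (q ^+ (2 * l - 1) - q ^- (2 * l - 1)))) *
    cyclo_coef q n j.
Proof.
move=> jn; rewrite /gen_cyclo_coef cyclo_ratio // series_coef_monomial ?eig_denom0 ?oner_neq0 //.
rewrite exprM (macdonald_ratio Q0 Q1 (n - j.+1) _
  (rogers_rec_eig_denom Q0 t0 _) (rogers_rec_principal Q0 Q1 j)) //.
rewrite prod_step_coef cyclo_coefE //.
have -> : (n - j.+1 + (2 * j).+1 = n + j)%N by lia.
have := brace_fact_neq0 Q0 Q1; have := brace_neq0 Q0 Q1 (ltn0Sn 0).
move: (quot_coef _ _ _) (\prod_(0 <= l < j) _) (brace Q 1) => g P b b0 F.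
move: (F (n + j)%N) (F (n - j.+1)%N) (F (2 * j).+1).
move: (brace_fact _ (n + _)) (brace_fact _ (n - _)) (brace_fact _ _.+1) => F1 F2 F3 h1 h2 h3.
by field; rewrite b0 h1 h2 h3.
Qed.
End Main.

Section Indeterminates.
Variable k : fieldType.

Lemma indet_neq0 (i : 'I_2) : tofrac ('X_i : {mpoly k[2]}) != 0.
Proof.
rewrite tofrac_eq0; apply: contra_neq (oner_neq0 k) => e.
by rewrite -(mevalXU (fun=> 1) i) e meval0.
Qed.

Lemma indet_exp_neq1 (i : 'I_2) n : (0 < n)%N -> tofrac ('X_i : {mpoly k[2]}) ^+ n != 1.
Proof.
move=> n0; rewrite -tofracXn -tofrac1 tofrac_eq.
apply: contra_neq (oner_neq0 k) => /(congr1 (meval (fun=> 0))).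
by rewrite rmorphXn /= mevalXU meval1 expr0n gtn_eqF.
Qed.
End Indeterminates.

Unset Implicit Arguments.

Theorem theorem1p4 (k : fieldType) (hk : [pchar k] =i pred0)
    (n i : nat) (hi : (1 <= i <= n)%N) :
  let q : {fraction {mpoly k[2]}} := indet_q k in
  let t : {fraction {mpoly k[2]}} := indet_t k in
  gen_cyclo_coef q t 1 n i.-1 =
    macdonald (n - i) (q ^+ (2 * i) * t^-1) (q ^+ 2) (q ^+ (2 * i)) /
    macdonald (n - i) (q ^+ (2 * i)) (q ^+ 2) (q ^+ (2 * i)) *
    (\prod_(2 <= l < i.+1)
       ((q ^+ (2 * l - 1) * t^-1 - q ^- (2 * l - 1) * t) /
        (q ^+ (2 * l - 1) - q ^- (2 * l - 1)))) *
    cyclo_coef q n i.-1.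
Proof.
case: i hi => [//|j] /andP[_ jn] q t.
apply: gen_cyclo_coefE jn; [exact: indet_neq0|exact: indet_neq0|exact: indet_exp_neq1].
Qed.
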